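(* Let $\sigma\in\{1212,1221\}$ and let $\tau$ be a matching. Then for every $n\geq 2$, $$|\mathcal{M}_{n}(\sigma(\tau+2))|=C_{n}+\sum_{\ell=2}^{n}\sum_{k=0}^{n-\ell}\binom{2\ell-1}{\ell-2}\binom{2\ell-1+k}{k}\binom{2(n-\ell)-k}{k}\,k!\,|\mathcal{M}_{n-\ell-k}(\tau)|.$$
   Context: A matching of order $n$ is a partition of $[2n]$ into blocks (edges) of size two, identified with the word in $[n]^{2n}$ where both vertices of an edge carry the same letter and letters appear in increasing order of left vertices (so $1212=\{\{1,3\},\{2,4\}\}$, $1221=\{\{1,4\},\{2,3\}\}$). A matching $\sigma$ of order $k$ is a pattern of $\tau$ if there are $i_1<\dots<i_{2k}$ with $\{i_p,i_q\}\in\tau$ iff $\{p,q\}\in\sigma$; otherwise $\tau$ avoids $\sigma$. $\mathcal{M}_n(S)$ is the set of matchings of order $n$ avoiding all patterns in $S$ ($\mathcal{M}_0(S)$ consists of the empty matching). $\sigma(\tau+2)$ is the word of $\sigma$ followed by the word of $\tau$ with $2$ added to each letter (juxtaposition). $C_n=\frac{1}{n+1}\binom{2n}{n}$. *)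

(* Defs.v *)
From mathcomp Require Import all_boot.
Set Implicit Arguments. Unset Strict Implicit. Unset Printing Implicit Defensive.

Definition is_matching (n : nat) (w : seq nat) : bool :=
  (undup w == iota 1 n) && all (fun i => count_mem i w == 2) (iota 1 n).

(* sigma is a pattern of tau: there are positions i_1 < ... < i_{2k} of tau
   (a subsequence selected by a mask) such that, for all p, q, positions
   i_p, i_q carry the same letter of tau (i.e. {i_p,i_q} is an edge of tau,
   for p <> q) iff p, q carry the same letter in sigma. *)
Definition contains_pattern (sigma tau : seq nat) : bool :=
  [exists m : (size tau).-tuple bool,
    (size (mask m tau) == size sigma) &&
    [forall p : 'I_(size sigma), forall q : 'I_(size sigma),
      (nth 0 (mask m tau) p == nth 0 (mask m tau) q)
        == (nth 0 sigma p == nth 0 sigma q)]].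

Definition avoids (tau sigma : seq nat) : bool := ~~ contains_pattern sigma tau.

Definition num_avoiding (n : nat) (sigma : seq nat) : nat :=
  #|[set t : (n.*2).-tuple 'I_n.+1 |
       is_matching n (map val t) && avoids (map val t) sigma ]|.

Definition juxt2 (sigma tau : seq nat) : seq nat := sigma ++ map (addn 2) tau.

Definition catalan (n : nat) : nat := 'C(n.*2, n) %/ n.+1.

(* Main.v *)
Require Import Defs.
From mathcomp Require Import all_boot zify.
Set Implicit Arguments. Unset Strict Implicit. Unset Printing Implicit Defensive.

(** Since [undup] keeps last occurrences, the word of a matching lists its edges
    by increasing right endpoints, so deleting the last edge of a matching of
    order n + 1 leaves one of order n, and conversely the left end of a new last
    edge can be inserted at 2n + 1 places.

    For sigma = 1212 or 1221, the sigma-avoiding matchings grow along the Catalan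
    tree (a node with m children has children with 2, ..., m + 1 children), so
    there are C_n of them.  Any other matching has a least l such that its first
    l edges contain sigma; these l edges form one of
    (2l - 1) C_(l-1) - C_l = binom(2l - 1, l - 2) matchings.  Cut the word just
    after the right end of edge l: the matching avoids sigma(tau + 2) iff the edges
    lying entirely after the cut avoid tau.  If k edges straddle the cut, their
    left ends can be placed in 2l (2l + 1) ... (2l + k - 1) ways, their right ends
    can be any k of the 2(n - l) - k positions after the cut, and the remaining
    positions carry an arbitrary tau-avoiding matching of order n - l - k. *)

(** * Pattern containment as injective relabelling *)

(** The relabelling sends a letter of [sigma] to the letter selected at its first occurrence. It is
    consistent and injective because equal letters sit at the same places on both sides. *)
Lemma contains_patternP (sigma w : seq nat) :
  reflect (exists2 f : nat -> nat,
             {in sigma &, injective f} & subseq (map f sigma) w)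
          (contains_pattern sigma w).
Proof.
apply: (iffP existsP) => [[m /andP[/eqP sz /forallP pat]]|[f inj_f]].
  set s := mask m w in sz pat.
  have patE p q : p < size sigma -> q < size sigma ->
      (nth 0 s p == nth 0 s q) = (nth 0 sigma p == nth 0 sigma q).
    by move=> hp hq; have /forallP/(_ (Ordinal hq))/eqP := pat (Ordinal hp).
  exists (fun a => nth 0 s (index a sigma)).
    move=> a b ha hb /eqP; rewrite patE ?index_mem // !nth_index //.
    by move/eqP.
  suff -> : map (fun a => nth 0 s (index a sigma)) sigma = s.
    exact: mask_subseq.
  apply: (@eq_from_nth _ 0); rewrite size_map // => i hi.
  rewrite (nth_map 0) //; apply/eqP.
  by rewrite patE ?index_mem ?mem_nth // nth_index ?mem_nth.
case/subseqP=> m /eqP szm Es; exists (Tuple szm); rewrite /= -Es size_map eqxx.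
apply/forallP=> p; apply/forallP=> q; rewrite !(nth_map 0) //.
by rewrite (inj_in_eq inj_f) ?mem_nth.
Qed.

Lemma contains_pattern_map (g : nat -> nat) (sigma w : seq nat) :
  {in w &, injective g} ->
  contains_pattern sigma (map g w) = contains_pattern sigma w.
Proof.
move=> inj_g; apply/contains_patternP/contains_patternP=> -[f inj_f sub].
  pose h y := nth 0 w (index y (map g w)).
  have hK : {in w, cancel g h}.
    move=> a ha; apply: inj_g => //.
      by rewrite /h mem_nth // -(size_map g) index_mem map_f.
    by rewrite /h -(nth_map 0 0) ?nth_index ?map_f // -(size_map g) index_mem map_f.
  exists (h \o f) => [a b ha hb /=|].
    have /mapP[a' ha' Ea] := mem_subseq sub (map_f f ha).
    have /mapP[b' hb' Eb] := mem_subseq sub (map_f f hb).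
    by rewrite Ea Eb !hK // => E; apply: inj_f; rewrite // Ea Eb E.
  rewrite map_comp; have -> : w = map h (map g w).
    by rewrite -map_comp map_id_in.
  exact: map_subseq.
exists (g \o f) => [a b ha hb /= E|]; last by rewrite map_comp map_subseq.
by apply: inj_f => //; apply: inj_g E; apply: (mem_subseq sub); apply: map_f.
Qed.

(** Every letter of [tau] is repeated, hence so is its image in [s]: letters that occur only once in
    [s] take no part in a copy of [tau]. *)
Lemma contains_pattern_filter (tau s : seq nat) (P : pred nat) :
  {in tau, forall a, 1 < count_mem a tau} ->
  {in s, forall y, 1 < count_mem y s -> P y} ->
  contains_pattern tau (filter P s) = contains_pattern tau s.
Proof.
move=> dbl hP; apply/contains_patternP/contains_patternP=> -[f inj_f sub];
  exists f => //.
  exact: subseq_trans sub (filter_subseq _ _).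
rewrite subseq_filter sub andbT; apply/allP=> _ /mapP[a ha ->].
apply: hP; first by rewrite (mem_subseq sub) ?map_f.
apply: leq_trans (leq_count_subseq _ sub); apply: leq_trans (dbl _ ha) _.
by rewrite count_map; apply: sub_count => b /= /eqP->.
Qed.

Lemma contains_pattern_subseq (sigma s t : seq nat) :
  subseq s t -> contains_pattern sigma s -> contains_pattern sigma t.
Proof.
move=> st /contains_patternP[f inj_f sub]; apply/contains_patternP.
by exists f => //; apply: subseq_trans sub st.
Qed.

(** * Copies of a juxtaposition in a word cut in two *)

Lemma subseq_cat_splitr (T : eqType) (s t1 t2 : seq T) :
  subseq s (t1 ++ t2) ->
  exists s1 s2, [/\ s = s1 ++ s2, subseq s1 t1 & subseq s2 t2].
Proof.
case/subseqP=> m szm ->; exists (mask (take (size t1) m) t1).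
exists (mask (drop (size t1) m) t2); rewrite !mask_subseq; split=> //.
rewrite -mask_cat ?cat_take_drop // size_takel // szm size_cat; lia.
Qed.

Lemma subseq_cat_splitl (T : eqType) (s1 s2 t : seq T) :
  subseq (s1 ++ s2) t ->
  exists t1 t2, [/\ t = t1 ++ t2, subseq s1 t1 & subseq s2 t2].
Proof.
elim: t s1 => [|y t IH] [|a s1] /= sub.
- by exists [::], [::].
- by [].
- by exists [::], (y :: t).
case: ifP sub => [/eqP Ey|ne] sub.
  have [t1 [t2 [-> h1 h2]]] := IH _ sub.
  by exists (y :: t1), t2; rewrite /= Ey eqxx.
have [t1 [t2 [-> h1 h2]]] := IH (a :: s1) sub.
by exists (y :: t1), t2; split=> //=; rewrite ne.
Qed.

Lemma subseq_rcons2 (T : eqType) (s t : seq T) (a x : T) :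
  subseq (rcons s a) (rcons t x) =
    if a == x then subseq s t else subseq (rcons s a) t.
Proof.
rewrite -[LHS]subseq_rev !rev_rcons /=.
by case: eqP => _; rewrite -?rev_rcons subseq_rev.
Qed.

(** Letters from [l] on occur at most once in [pre], so a copy of [sigma] inside [pre] would only
    use letters below [l], and those avoid [sigma]. Hence the [sigma] part of any copy reaches the
    displayed [l] and leaves its [tau] part inside [suf]. Conversely, a copy of [sigma] on letters
    up to [l] and a copy of [tau] in [suf], on letters above [l], combine without clash. *)
Lemma contains_juxt2 (sigma tau pre suf : seq nat) (l : nat) :
  {in sigma, forall a, 1 < count_mem a sigma} -> {in sigma, forall a, a <= 2} ->
  {in tau, forall a, 0 < a} ->
  contains_pattern sigma [seq y <- rcons pre l | y <= l] ->
  ~~ contains_pattern sigma [seq y <- rcons pre l | y < l] ->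
  (forall y, l <= y -> count_mem y pre <= 1) ->
  all (ltn l) suf ->
  contains_pattern (juxt2 sigma tau) (rcons pre l ++ suf)
    = contains_pattern tau suf.
Proof.
move=> dbl small pos has_s no_s once gt_l; apply/idP/idP.
  case/contains_patternP=> f inj_f; rewrite map_cat.
  case/subseq_cat_splitl=> w1 [w2 [Ew sub1 sub2]].
  have [le_w1|gt_w1] := leqP (size w1) (size pre).
    case/negP: no_s; rewrite filter_rcons ltnn contains_pattern_filter //.
      apply/contains_patternP; exists f.
        by move=> a b ha hb; apply: inj_f; rewrite mem_cat ?ha ?hb.
      apply: subseq_trans sub1 _.
      have <- : take (size w1) pre = w1.
        have := congr1 (take (size w1)) Ew.
        by rewrite take_size_cat // cat_rcons takel_cat.
      by rewrite -[X in subseq _ X](cat_take_drop (size w1)) prefix_subseq.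
    move=> y _ cy; rewrite ltnNge; apply/negP=> /once; lia.
  apply/contains_patternP; exists (f \o addn 2).
    move=> a b ha hb /= E.
    have {}E : 2 + a = 2 + b.
      by apply: inj_f E; rewrite mem_cat map_f ?orbT.
    lia.
  rewrite map_comp; apply: subseq_trans sub2 _.
  have := congr1 (drop (size w1)) Ew.
  rewrite drop_size_cat // drop_cat size_rcons ltnNge gt_w1 /= => <-.
  rewrite -{2}(cat_take_drop (size w1 - (size pre).+1) suf).
  exact: suffix_subseq.
case/contains_patternP=> h inj_h sub_h.
case/contains_patternP: has_s => g inj_g sub_g.
have gle a : a \in sigma -> g a <= l.
  by move=> /(map_f g)/(mem_subseq sub_g); rewrite mem_filter => /andP[].
have hgt a : a \in tau -> l < h a.
  by move=> /(map_f h)/(mem_subseq sub_h)/(allP gt_l).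
have gt2 a : a \in tau -> (2 + a <= 2) = false by move/pos; lia.
(* The threshold 2 separates the letters of [sigma] from those of the shifted [tau]. *)
apply/contains_patternP; exists (fun a => if a <= 2 then g a else h (a - 2)).
  move=> a b; rewrite !mem_cat => /orP[ha|/mapP[a' ha' ->]] /orP[hb|/mapP[b' hb' ->]].
  - by rewrite !small //; apply: inj_g.
  - rewrite small // gt2 // addKn => E; have := gle _ ha; have := hgt _ hb'; lia.
  - rewrite (small b) // gt2 // addKn => E; have := gle _ hb; have := hgt _ ha'; lia.
  by rewrite !gt2 // !addKn => /inj_h->.
rewrite map_cat; apply: cat_subseq.
  rewrite (@eq_in_map _ _ _ g sigma).1.
    exact: subseq_trans sub_g (filter_subseq _ _).
  by move=> a ha; rewrite small.
rewrite -map_comp (@eq_in_map _ _ _ h tau).1 // => a ha /=.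
by rewrite gt2 ?addKn.
Qed.

(** * Building matchings by adding last edges *)

Definition insert (T : Type) (j : nat) (x : T) (w : seq T) : seq T :=
  take j w ++ x :: drop j w.

Definition push (w : seq nat) (j : nat) : seq nat :=
  let x := (size w)./2.+1 in rcons (insert j x w) x.

Fixpoint grow (d : nat) (w : seq nat) : seq (seq nat) :=
  if d is d'.+1 then
    [seq push w' j | w' <- grow d' w, j <- iota 0 (size w').+1]
  else [:: w].

(** An invariant of [push] under which the added letter is new. *)
Definition bounded (w : seq nat) : bool := all (fun y => y <= (size w)./2) w.

Lemma size_insert (T : Type) (j : nat) (x : T) (w : seq T) :
  size (insert j x w) = (size w).+1.
Proof. by rewrite size_cat /= addnS -size_cat cat_take_drop. Qed.

Lemma size_push (w : seq nat) (j : nat) : size (push w j) = (size w).+2.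
Proof. by rewrite size_rcons size_insert. Qed.

Lemma count_insert (T : Type) (a : pred T) (j : nat) (x : T) (w : seq T) :
  count a (insert j x w) = a x + count a w.
Proof. by rewrite -{2}(cat_take_drop j w) !count_cat /= addnCA. Qed.

Lemma mem_insert (T : eqType) (j : nat) (x y : T) (w : seq T) :
  (y \in insert j x w) = (y == x) || (y \in w).
Proof. by rewrite -{2}(cat_take_drop j w) !mem_cat inE orbCA. Qed.

Lemma map_insert (T1 T2 : Type) (f : T1 -> T2) (j : nat) (x : T1) (w : seq T1) :
  map f (insert j x w) = insert j (f x) (map f w).
Proof. by rewrite map_cat /= map_take map_drop. Qed.

Lemma filter_insert (T : Type) (a : pred T) (j : nat) (x : T) (w : seq T) :
  filter a (insert j x w) =
    if a x then insert (count a (take j w)) x (filter a w) else filter a w.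
Proof.
rewrite /insert -[in RHS](cat_take_drop j w) !filter_cat /= cat_take_drop.
case: (a x) => //=; rewrite -size_filter take_size_cat // drop_size_cat //.
Qed.

Lemma bounded_push (w : seq nat) (j : nat) : bounded w -> bounded (push w j).
Proof.
move=> /allP bw; apply/allP=> y; rewrite size_push /= mem_rcons inE mem_insert.
by case/or3P=> [/eqP->|/eqP->|/bw]; lia.
Qed.

Lemma bounded_fresh (w : seq nat) : bounded w -> (size w)./2.+1 \notin w.
Proof. by move=> /allP bw; apply/negP=> /bw; rewrite ltnn. Qed.

(** This inverse of [push] gives both the uniqueness of generated words and the fact that avoidance
    passes from [push w j] to [w]. *)
Lemma filter_neq_push (w : seq nat) (j : nat) :
  bounded w -> [seq y <- push w j | y != (size w)./2.+1] = w.
Proof.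
move/bounded_fresh=> fr; rewrite /push /= filter_rcons eqxx /= filter_insert.
rewrite eqxx /=; apply/all_filterP/allP=> y hy.
by apply: contraNneq fr => <-.
Qed.

Lemma big_growS (d : nat) (w : seq nat) (P : pred (seq nat)) (F : seq nat -> nat) :
  \sum_(w' <- grow d.+1 w | P w') F w' =
  \sum_(w' <- grow d w) \sum_(j < (size w').+1 | P (push w' j)) F (push w' j).
Proof.
have -> : grow d.+1 w =
    [seq push w' j | w' <- grow d w, j <- index_iota 0 (size w').+1] by [].
rewrite big_mkcond big_allpairs_dep; apply: eq_bigr => w' _.
by rewrite big_mkord -big_mkcond.
Qed.

Lemma big_growSr (d : nat) (w : seq nat) (F : seq nat -> nat) :
  \sum_(w' <- grow d.+1 w) F w' =
  \sum_(j < (size w).+1) \sum_(w' <- grow d (push w j)) F w'.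
Proof.
elim: d F => [|d IH] F.
  by rewrite big_growS big_seq1; apply: eq_bigr => j _; rewrite big_seq1.
by rewrite big_growS IH; apply: eq_bigr => j _; rewrite big_growS.
Qed.

Lemma growP (d : nat) (w w' : seq nat) :
  bounded w -> w' \in grow d w ->
  bounded w' /\ size w' = size w + d.*2.
Proof.
move=> bw; elim: d w' => [|d IH] w'.
  by rewrite inE => /eqP->; rewrite addn0.
case/allpairsPdep=> v [j [/IH[bv sv] _ ->]].
by rewrite bounded_push // size_push sv doubleS !addnS.
Qed.

Lemma matsP (n : nat) (w : seq nat) :
  w \in grow n [::] -> bounded w /\ size w = n.*2.
Proof. exact: growP. Qed.

(** From [push w j], deleting the new letter recovers [w], and the index of its first occurrence
    recovers [j]. *)
Lemma grow_uniq (n : nat) : uniq (grow n [::]).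
Proof.
elim: n => // n IH; apply: (@allpairs_uniq_dep _ (fun=> nat) _ push) => // [w _|].
  exact: iota_uniq.
move=> _ _ /allpairsPdep[w [j [hw hj ->]]] /allpairsPdep[v [i [hv hi ->]]] /=.
have [bw sw] := matsP hw; have [bv sv] := matsP hv => E.
have Ewv : w = v.
  by rewrite -(filter_neq_push j bw) E sw -sv filter_neq_push.
rewrite -{}Ewv in hi E *; congr (Tagged _ _).
have fr := bounded_fresh bw.
have idx k : k \in iota 0 (size w).+1 -> index (size w)./2.+1 (push w k) = k.
  rewrite mem_iota /= ltnS => hk; rewrite /push /insert /= rcons_cat index_cat.
  rewrite ifN /= ?eqxx ?addn0 ?size_takel //.
  by apply: contra fr; apply: mem_take.
by rewrite -(idx j hj) E idx.
Qed.

Lemma iota1_rcons (n : nat) : iota 1 n.+1 = rcons (iota 1 n) n.+1.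
Proof. by rewrite -[in LHS](addn1 n) iotaD cats1 add1n. Qed.

Lemma mem_grow_matching (n : nat) (w : seq nat) :
  (w \in grow n [::]) = is_matching n w.
Proof.
elim: n w => [|n IH] w.
  rewrite inE /is_matching /= andbT; case: w => // x w.
  apply/esym/negP=> /eqP E.
  by have := mem_undup (x :: w) x; rewrite E mem_head.
apply/idP/idP.
  case/allpairsPdep=> v [j [hv _ ->]]; have [bv sv] := matsP hv.
  move: hv; rewrite IH => /andP[/eqP uv /allP cv].
  have fr := bounded_fresh bv; have := filter_neq_push j bv.
  rewrite sv doubleK in fr; rewrite /push sv doubleK /= filter_rcons eqxx /= => fp.
  rewrite /is_matching iota1_rcons undup_rcons filter_undup fp uv eqxx /=.
  apply/allP=> i; rewrite mem_rcons inE => hi.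
  rewrite -cats1 count_cat count_insert /= addn0 [n.+1 == i]eq_sym.
  case/orP: hi => [/eqP->|hi]; first by rewrite eqxx (count_memPn fr).
  have := cv _ hi; rewrite (_ : i == n.+1 = false) ?addn0 //.
  by move: hi; rewrite mem_iota; lia.
case/lastP: w => [|s x]; first by rewrite /is_matching.
(* As [undup] keeps last occurrences, the last letter must be [n.+1]; deleting its two occurrences
   leaves a matching of order [n]. *)
case/andP=> /eqP; rewrite undup_rcons filter_undup.
rewrite iota1_rcons => /rcons_inj[Eu Ex] /allP cs.
have cx : count_mem x s = 1.
  have := cs x; rewrite -cats1 mem_cat Ex mem_seq1 eqxx orbT => /(_ isT).
  by rewrite -cats1 count_cat /= eqxx => /eqP; lia.
have xs : x \in s by rewrite -has_pred1 has_count cx.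
have [s1 [s2 Es]] : exists s1 s2, s = s1 ++ x :: s2.
  by case/splitPr: xs => s1 s2; exists s1, s2.
have [x1 x2] : x \notin s1 /\ x \notin s2.
  move: cx; rewrite Es count_cat /= eqxx addnS => -[/eqP].
  by rewrite addn_eq0 => /andP[/eqP/count_memPn ? /eqP/count_memPn].
have Ef : [seq y <- s | y != x] = s1 ++ s2.
  rewrite Es filter_cat /= eqxx /=; congr (_ ++ _); apply/all_filterP/allP => y hy.
    by apply: contraNneq x1 => <-.
  by apply: contraNneq x2 => <-.
have hv : s1 ++ s2 \in grow n [::].
  rewrite IH /is_matching -Ef Eu eqxx; apply/allP=> i hi.
  have ix : i == x = false by move: hi; rewrite Ex mem_iota; lia.
  have := cs i; rewrite -cats1 mem_cat hi => /(_ isT) /eqP.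
  rewrite -cats1 count_cat /= eq_sym ix addn0 addn0 Ef Es !count_cat /= eq_sym ix.
  by move=> <-.
have [_ sv] := matsP hv.
apply/allpairsPdep; exists (s1 ++ s2), (size s1); split=> //.
  by rewrite mem_iota /= size_cat; lia.
rewrite /push sv doubleK /= -Ex /insert take_size_cat // drop_size_cat //.
by rewrite Es.
Qed.

Lemma num_avoidingE (n : nat) (pat : seq nat) :
  num_avoiding n pat = \sum_(w <- grow n [::] | avoids w pat) 1.
Proof.
rewrite sum1_count -size_filter /num_avoiding cardE.
rewrite -(size_map (fun t : n.*2.-tuple 'I_n.+1 => map val t)).
apply: perm_size; apply: uniq_perm.
- rewrite map_inj_uniq ?enum_uniq // => t1 t2 /(inj_map val_inj).
  exact: val_inj.
- by rewrite filter_uniq // grow_uniq.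
move=> w; rewrite mem_filter; apply/mapP/andP.
  case=> t; rewrite mem_enum inE => /andP[mt av] ->.
  by rewrite mem_grow_matching.
case=> av hw; have [/allP bw sw] := matsP hw.
(* The letters of [w] are at most [n], so [inord] loses nothing. *)
have szw : size (map (@inord n) w) == n.*2 by rewrite size_map sw.
have Ew : map val (Tuple szw) = w.
  rewrite /= -map_comp map_id_in // => y /bw; rewrite sw doubleK => hy.
  by rewrite /= inordK.
by exists (Tuple szw); rewrite ?mem_enum ?inE Ew // -mem_grow_matching hw.
Qed.

(** * The Catalan tree and ballot numbers *)

(* Number of nodes at depth r below a node with m children in the Catalan tree. *)
Fixpoint tree (r m : nat) : nat :=
  if r is r'.+1 then \sum_(i < m) tree r' i.+2 else 1.

Lemma treeS (r m : nat) : tree r.+1 m.+1 = tree r.+1 m + tree r m.+2.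
Proof. by rewrite [LHS]big_ord_recr. Qed.

(** Ballot numbers, written additively to avoid truncated subtraction. The recursion [treeS] matches
    Pascal's rule on both binomials, which agree by symmetry at [m = 0]. *)
Lemma treeE (r m : nat) :
  tree r.+1 m + 'C(r.*2 + m.+1, r) = 'C(r.*2 + m.+1, r.+1).
Proof.
elim: r m => [|r IHr] m.
  by rewrite /= sum1_card card_ord bin0 bin1 double0 add0n addn1.
elim: m => [|m IHm].
  rewrite [tree _ _]big_ord0 add0n -bin_sub; last by lia.
  by congr 'C(_, _); lia.
rewrite treeS; have := IHr m.+2; rewrite (_ : r.*2 + m.+3 = r.+1.*2 + m.+1); last by lia.
by rewrite (addnS r.+1.*2 m.+1) !(binS (r.+1.*2 + m.+1)); move: IHm; lia.
Qed.

Lemma tree_catalan (n : nat) : tree n 1 = catalan n.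
Proof.
case: n => [|n]; first by rewrite /= /catalan /= bin0 divn1.
rewrite /catalan; have := treeE n 1; rewrite [n.*2 + 2](_ : _ = n.+1.*2); last by lia.
have := mul_bin_left n.+1.*2 n; rewrite (_ : n.+1.*2 - n = n.+2); last by lia.
move=> E1 E2; suff <- : tree n.+1 1 * n.+2 = 'C(n.+1.*2, n.+1) by rewrite mulnK.
by move: E1; rewrite -E2; move: 'C(_, _) (tree _ _) => a b; nia.
Qed.

(** With l = r + 2 this is (2l - 1) C_(l-1) = C_l + binom(2l - 1, l - 2). Both sides equal
    ['C(r.*2.+3, r.+1)]. *)
Lemma tree_first_bad (r : nat) :
  r.*2.+3 * tree r.+1 1 = tree r.+2 1 + 'C(r.*2.+3, r).
Proof.
have := treeE r 1; rewrite addn2 => E1.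
have := treeE r.+1 1; rewrite (_ : r.+1.*2 + 2 = r.*2.+4); last by lia.
rewrite !(binS r.*2.+3).
have -> : 'C(r.*2.+3, r.+2) = 'C(r.*2.+3, r.+1).
  by rewrite -bin_sub; [congr 'C(_, _)|]; lia.
move=> E0; have {E0}-> : tree r.+2 1 + 'C(r.*2.+3, r) = 'C(r.*2.+3, r.+1) by lia.
have := mul_bin_left r.*2.+2 r; rewrite (_ : r.*2.+2 - r = r.+2); last by lia.
move=> E2; have E3 : r.+2 * tree r.+1 1 = 'C(r.*2.+2, r.+1).
  by move: E2; rewrite -E1; nia.
have := mul_bin_diag r.*2.+3 r.+1 => /=.
have -> : 'C(r.*2.+3, r.+2) = 'C(r.*2.+3, r.+1).
  by rewrite -bin_sub; [congr 'C(_, _)|]; lia.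
by rewrite -E3 mulnCA => /eqP; rewrite eqn_pmul2l // => /eqP.
Qed.

(** * The generating tree of matchings avoiding 1212 or 1221 *)

Definition live (good : pred (seq nat)) (w : seq nat) : nat :=
  count (fun j => good (push w j)) (iota 0 (size w).+1).

(** The indices satisfying [P] have ranks 1, 2, ... in order. This turns a sum over insertion places
    into a sum over the numbers of children. *)
Lemma sum_rank (P : pred nat) (phi : nat -> nat) (N : nat) :
  \sum_(j < N | P j) phi (count P (iota 0 j.+1)) =
  \sum_(i < count P (iota 0 N)) phi i.+1.
Proof.
have cE n : count P (iota 0 n.+1) = count P (iota 0 n) + P n.
  by rewrite -(addn1 n) iotaD count_cat /= add0n addn0.
elim: N => [|N IH]; first by rewrite !big_ord0.
rewrite big_mkcond big_ord_recr -big_mkcond IH !cE.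
case: (P N) => /=; last by rewrite !addn0.
by rewrite [in RHS]addn1 big_ord_recr addn1.
Qed.

(** The hypotheses state the Catalan rule: the root has one child, and the children of a node with m
    children have 2, ..., m + 1 children. The parameter [r] carries the induction on [n], which
    moves one level at a time from [grow] to [tree]; [r = 0] counts the good words. *)
Lemma sum_tree (good : pred (seq nat)) :
  good [::] -> live good [::] = 1 ->
  (forall w j, bounded w -> good (push w j) -> good w) ->
  (forall w phi, bounded w -> good w ->
     \sum_(j < (size w).+1 | good (push w j)) phi (live good (push w j)) =
     \sum_(i < live good w) phi i.+2) ->
  forall n r, \sum_(w <- grow n [::] | good w) tree r (live good w) = tree (n + r) 1.
Proof.
move=> good0 live0 good_push step n; elim: n => [|n IH] r.
  by rewrite big_mkcond big_seq1 good0 live0.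
rewrite big_growS addSnnS -IH [RHS]big_mkcond /= big_seq_cond [RHS]big_seq_cond.
apply: eq_bigr => w /andP[/matsP[bw _] _]; case: ifP => gw.
  by rewrite (step w (tree r)).
by rewrite big_pred0 // => j; apply: contraFF gw; apply: good_push.
Qed.

Lemma avoids_pushW (sigma w : seq nat) (j : nat) :
  bounded w -> avoids (push w j) sigma -> avoids w sigma.
Proof.
move=> bw; apply: contra; apply: contains_pattern_subseq.
by rewrite -{1}(filter_neq_push j bw) filter_subseq.
Qed.

Lemma contains_1212P (w : seq nat) :
  reflect (exists a b, a != b /\ subseq [:: a; b; a; b] w)
          (contains_pattern [:: 1; 2; 1; 2] w).
Proof.
apply: (iffP (contains_patternP _ _)) => [[f inj_f sub]|[a [b [ab sub]]]].
  exists (f 1), (f 2); split=> //; apply/eqP=> /inj_f.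
  by rewrite !inE => /(_ isT isT).
exists (fun i => if i == 1 then a else b) => //.
move=> i j; rewrite !inE => hi hj.
have [->|i1] := eqVneq i 1; have [->|j1] := eqVneq j 1 => // E.
- by rewrite E eqxx in ab.
- by rewrite E eqxx in ab.
- by move: hi hj i1 j1 => /= hi hj i1 j1; lia.
Qed.

Lemma contains_1221P (w : seq nat) :
  reflect (exists a b, a != b /\ subseq [:: a; b; b; a] w)
          (contains_pattern [:: 1; 2; 2; 1] w).
Proof.
apply: (iffP (contains_patternP _ _)) => [[f inj_f sub]|[a [b [ab sub]]]].
  exists (f 1), (f 2); split=> //; apply/eqP=> /inj_f.
  by rewrite !inE => /(_ isT isT).
exists (fun i => if i == 1 then a else b) => //.
move=> i j; rewrite !inE => hi hj.
have [->|i1] := eqVneq i 1; have [->|j1] := eqVneq j 1 => // E.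
- by rewrite E eqxx in ab.
- by rewrite E eqxx in ab.
- by move: hi hj i1 j1 => /= hi hj i1 j1; lia.
Qed.

(* The new letter ends the word, so in a copy of 1212 it can only play the 2. *)
Lemma avoids_push_1212 (w : seq nat) (j : nat) :
  bounded w -> avoids w [:: 1; 2; 1; 2] ->
  avoids (push w j) [:: 1; 2; 1; 2] = ~~ has (mem (take j w)) (drop j w).
Proof.
move=> bw av; congr negb; set x := (size w)./2.+1; have fr := bounded_fresh bw.
have [fA fB] : x \notin take j w /\ x \notin drop j w.
  by split; [apply: contra fr; apply: mem_take|apply: contra fr; apply: mem_drop].
apply/contains_1212P/hasP=> [[a [b [ab sub]]]|[a aB aA]]; last first.
  have ax : a != x by apply: contraNneq fA => <-.
  exists a, x; split=> //; rewrite /push /insert /= -cats1 -catA.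
  rewrite -[[:: a; x; a; x]]/([:: a] ++ [:: x] ++ [:: a] ++ [:: x]).
  apply: cat_subseq; first by rewrite sub1seq.
  apply: (@cat_subseq _ [:: x; a] [:: x] (x :: drop j w)); last exact: subseq_refl.
  by rewrite /= eqxx sub1seq.
have [Ex|xb] := eqVneq b x; last first.
  have [Ex|xa] := eqVneq a x.
    move: sub; rewrite /push -[[:: a; b; a; b]]/(rcons [:: a; b; a] b).
    rewrite subseq_rcons2 (negPf xb) => /(leq_count_subseq (pred1 a)).
    rewrite count_insert -/x /= Ex eqxx (count_memPn fr).
    by rewrite (negPf xb).
  case/negP: av; apply/contains_1212P; exists a, b; split=> //.
  by rewrite -(filter_neq_push j bw) subseq_filter sub /= xa xb.
rewrite {}Ex in ab sub; move: sub; rewrite /push.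
rewrite -[[:: a; x; a; x]]/(rcons [:: a; x; a] x) subseq_rcons2 eqxx.
case/subseq_cat_splitr=> s1 [s2 []]; case: s1 => [|a1 [|x1 s1]] /=.
- move=> <- _; rewrite (negPf ab) => /mem_subseq/(_ x).
  by rewrite !inE eqxx orbT (negPf fB) => /(_ isT).
- case=> <- <-; rewrite sub1seq eqxx => aA; rewrite sub1seq => aB.
  by exists a.
- by case=> _ <- _ /mem_subseq/(_ x); rewrite !inE eqxx orbT (negPf fA) => /(_ isT).
Qed.

(** The new letter ends the word, so in a copy of 1221 it can only play the 1; the copy then needs a
    repeated letter after its left end. *)
Lemma avoids_push_1221 (w : seq nat) (j : nat) :
  bounded w -> avoids w [:: 1; 2; 2; 1] ->
  avoids (push w j) [:: 1; 2; 2; 1] = uniq (drop j w).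
Proof.
move=> bw av; set x := (size w)./2.+1; have fr := bounded_fresh bw.
have [fA fB] : x \notin take j w /\ x \notin drop j w.
  by split; [apply: contra fr; apply: mem_take|apply: contra fr; apply: mem_drop].
apply/idP/idP=> [|uB].
  apply: contraNT => /(uniqPn 0)[i1 [i2 [lt12 lt2 E]]].
  set b := nth 0 (drop j w) i1.
  have bB : b \in drop j w by rewrite mem_nth // (ltn_trans lt12).
  have bx : x != b by apply: contraNneq fB => ->.
  apply/contains_1221P; exists x, b; split=> //.
  rewrite /push /insert /= -/x -[[:: x; b; b; x]]/(rcons ([::] ++ [:: x; b; b]) x).
  rewrite subseq_rcons2 eqxx; apply: cat_subseq; first exact: sub0seq.
  rewrite /= eqxx -(cat_take_drop i2 (drop j w)) -[[:: b; b]]/([:: b] ++ [:: b]).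
  apply: cat_subseq; rewrite sub1seq.
    by rewrite /b -(nth_take 0 lt12) mem_nth // size_takel // ltnW.
  have <- : nth 0 (drop i2 (drop j w)) 0 = b by rewrite nth_drop addn0 -E.
  by rewrite mem_nth // [size (drop i2 _)]size_drop subn_gt0.
apply/contains_1221P=> -[a [b [ab sub]]].
have [Ex|xa] := eqVneq a x; last first.
  have [Ex|xb] := eqVneq b x.
    move: sub; rewrite /push -[[:: a; b; b; a]]/(rcons [:: a; b; b] a).
    rewrite subseq_rcons2 (negPf xa) => /(leq_count_subseq (pred1 b)).
    rewrite count_insert -/x /= Ex eqxx (count_memPn fr).
    by rewrite (negPf xa).
  case/negP: av; apply/contains_1221P; exists a, b; split=> //.
  by rewrite -(filter_neq_push j bw) subseq_filter sub /= xa xb.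
rewrite {}Ex in ab sub; move: sub; rewrite /push.
rewrite -[[:: x; b; b; x]]/(rcons [:: x; b; b] x) subseq_rcons2 eqxx.
case/subseq_cat_splitr=> s1 [s2 []]; case: s1 => [|x1 s1] /=.
  by move=> <- _; rewrite eqxx => /subseq_uniq/(_ uB); rewrite /= inE eqxx.
by case=> <- _ /mem_subseq/(_ x); rewrite inE eqxx (negPf fA) => /(_ isT).
Qed.

Lemma drop_catl (T : Type) (i : nat) (s t : seq T) :
  i <= size s -> drop i (s ++ t) = drop i s ++ t.
Proof.
rewrite drop_cat leq_eqVlt => /orP[/eqP->|->//].
by rewrite ltnn subnn drop0 drop_size.
Qed.

Lemma count_iota_sum (P : pred nat) (n : nat) :
  count P (iota 0 n) = \sum_(j < n | P j) 1.
Proof. by rewrite -sum1_count -{1}[n]subn0 big_mkord. Qed.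

(** Places up to [j] are good exactly when they were good for [w]. Any later place but the last
    separates the two ends of the new edge, which is bad; the last place is always good. *)
Lemma live_push_1212 (w : seq nat) (j : nat) (good := avoids^~ [:: 1; 2; 1; 2]) :
  bounded w -> good w -> j <= size w -> good (push w j) ->
  live good (push w j) = (count (fun i => good (push w i)) (iota 0 j.+1)).+1.
Proof.
move=> bw gw hj gv; have bv := bounded_push j bw.
rewrite /live size_push.
have -> : (size w).+3 = j.+1 + ((size w - j).+1 + 1) by lia.
rewrite !iotaD !count_cat !add0n.
have Ev : push w j = take j w ++ ((size w)./2.+1 :: drop j w ++ [:: (size w)./2.+1]).
  by rewrite /push /insert -cats1 -catA.
set x := (size w)./2.+1 in Ev; have fr : x \notin w by exact: bounded_fresh.
have szA : size (take j w) = j by rewrite size_takel.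
rewrite (_ : count _ (iota j.+1 _) = 0) ?add0n; last first.
  apply/eqP; rewrite eqn0Ngt -has_count; apply/hasPn=> i; rewrite mem_iota => hi.
  rewrite /good avoids_push_1212 // negbK; apply/hasP; exists x; rewrite /= Ev.
    rewrite drop_cat szA ifN; last by lia.
    rewrite (_ : i - j = (i - j).-1.+1) /=; last by lia.
    by rewrite drop_catl ?mem_cat ?mem_head ?orbT // size_drop; lia.
  rewrite take_cat szA ifN; last by lia.
  rewrite (_ : i - j = (i - j).-1.+1) /=; last by lia.
  by rewrite mem_cat inE eqxx orbT.
rewrite [count _ (iota _ 1)](_ : _ = 1); last first.
  rewrite /= /good avoids_push_1212 // drop_oversize ?size_push //; lia.
rewrite addn1; congr _.+1; apply: eq_in_count => i; rewrite mem_iota /= add0n ltnS => hi.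
rewrite /good (avoids_push_1212 i bv gv) (avoids_push_1212 i bw gw) Ev takel_cat ?szA // drop_catl ?szA //.
have Et : take i (take j w) = take i w by rewrite take_takel.
have Ed : drop i w = drop i (take j w) ++ drop j w.
  by rewrite -{1}(cat_take_drop j w) drop_catl // szA.
have xt : x \in take i w = false by apply: contraNF fr; apply: mem_take.
by rewrite Et Ed !has_cat /= has_cat /= xt !orbF.
Qed.

(** At places up to [j] both ends of the new edge follow, which is bad. Every later place is
    followed by a suffix of [drop j w] and the new letter, all distinct. *)
Lemma live_push_1221 (w : seq nat) (j : nat) (good := avoids^~ [:: 1; 2; 2; 1]) :
  bounded w -> good w -> j <= size w -> good (push w j) ->
  live good (push w j) = (size w - j).+2.
Proof.
move=> bw gw hj gv; have bv := bounded_push j bw.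
have uB : uniq (drop j w) by rewrite -avoids_push_1221.
rewrite /live size_push.
have -> : (size w).+3 = j.+1 + (size w - j).+2 by lia.
rewrite iotaD count_cat add0n.
have Ev : push w j = take j w ++ ((size w)./2.+1 :: drop j w ++ [:: (size w)./2.+1]).
  by rewrite /push /insert -cats1 -catA.
set x := (size w)./2.+1 in Ev; have fr : x \notin w by exact: bounded_fresh.
have szA : size (take j w) = j by rewrite size_takel.
rewrite (_ : count _ (iota 0 _) = 0) ?add0n; last first.
  apply/eqP; rewrite eqn0Ngt -has_count; apply/hasPn=> i; rewrite mem_iota => hi.
  rewrite /good avoids_push_1221 // Ev drop_catl ?szA; last by lia.
  by rewrite cat_uniq /= mem_cat inE eqxx orbT /= !andbF.
rewrite -[RHS](size_iota j.+1); apply/eqP; rewrite -all_count; apply/allP=> i.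
rewrite mem_iota => hi; rewrite /good avoids_push_1221 // Ev drop_cat szA ifN; last by lia.
rewrite (_ : i - j = (i - j).-1.+1) /=; last by lia.
apply: drop_uniq; rewrite cat_uniq uB /= orbF andbT.
by apply: contra fr; apply: mem_drop.
Qed.

Lemma step_1212 (w : seq nat) (phi : nat -> nat) (good := avoids^~ [:: 1; 2; 1; 2]) :
  bounded w -> good w ->
  \sum_(j < (size w).+1 | good (push w j)) phi (live good (push w j)) =
  \sum_(i < live good w) phi i.+2.
Proof.
move=> bw gw.
rewrite -(sum_rank (fun j => good (push w j)) (fun i => phi i.+1)).
by apply: eq_bigr => j gj; rewrite live_push_1212 // -ltnS.
Qed.

Lemma step_1221 (w : seq nat) (phi : nat -> nat) (good := avoids^~ [:: 1; 2; 2; 1]) :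
  bounded w -> good w ->
  \sum_(j < (size w).+1 | good (push w j)) phi (live good (push w j)) =
  \sum_(i < live good w) phi i.+2.
Proof.
move=> bw gw; set N := size w.
(* Places are counted from the right end: the good ones then form an initial interval, so a good
   place [j] has rank [j.+1]. *)
pose P i := good (push w (N - i)).
have -> : live good w = count P (iota 0 N.+1).
  rewrite /live !count_iota_sum (reindex_inj rev_ord_inj).
  by apply: eq_bigl => j; rewrite /P /= subSS.
rewrite -(sum_rank P (fun i => phi i.+1)) (reindex_inj rev_ord_inj).
rewrite (eq_bigl (fun j : 'I_N.+1 => P j)); last first.
  by move=> j; rewrite /P /= subSS.
apply: eq_bigr => j Pj; have hj := ltn_ord j.
have -> : rev_ord j = N - j :> nat by rewrite /= subSS.
rewrite live_push_1221 ?leq_subr // -/N; congr (phi _.+1).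
rewrite (_ : N - (N - j) = j); last by lia.
rewrite -[LHS](size_iota 0); apply/esym/eqP; rewrite -all_count; apply/allP=> i.
rewrite mem_iota => hi; rewrite /P /good avoids_push_1221 //.
move: Pj; rewrite /P /good avoids_push_1221 //.
rewrite (_ : N - i = (j - i) + (N - j)); last by lia.
by rewrite -drop_drop; apply: drop_uniq.
Qed.

Lemma sum_good_tree (sigma : seq nat) (n : nat) :
  sigma = [:: 1; 2; 1; 2] \/ sigma = [:: 1; 2; 2; 1] ->
  \sum_(w <- grow n [::] | avoids w sigma) 1 = tree n 1.
Proof.
have small s w : size w < size s -> avoids w s.
  move=> lt; apply/contains_patternP=> -[f _ /size_subseq].
  by rewrite size_map leqNgt lt.
move=> hs; rewrite -[n in RHS]addn0 -(@sum_tree (avoids^~ sigma)) //.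
- by case: hs => ->; rewrite small.
- by case: hs => ->; rewrite /live /= small.
- by move=> w j; apply: avoids_pushW.
by case: hs => ->; [apply: step_1212|apply: step_1221].
Qed.

(** * Sums over bit sequences *)

(* Sum of f over the bit sequences of length N with k ones. *)
Fixpoint bsum (N k : nat) (f : bitseq -> nat) : nat :=
  if N is N'.+1 then
    bsum N' k (fun b => f (rcons b false)) +
    (if k is k'.+1 then bsum N' k' (fun b => f (rcons b true)) else 0)
  else (k == 0) * f [::].

Lemma bsumS (N k : nat) (f : bitseq -> nat) :
  bsum N.+1 k f =
    bsum N k (fun b => f (rcons b false)) +
    (if k is k'.+1 then bsum N k' (fun b => f (rcons b true)) else 0).
Proof. by []. Qed.

Lemma eq_bsum (N k : nat) (f g : bitseq -> nat) :
  (forall b, size b = N -> count id b = k -> f b = g b) -> bsum N k f = bsum N k g.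
Proof.
elim: N k f g => [|N IH] k f g E /=.
  by case: k E => [|k] E //; rewrite E.
congr (_ + _).
  by apply: IH => b sb cb; apply: E; rewrite ?size_rcons ?sb // -cats1 count_cat /= !addn0.
case: k E => // k E; apply: IH => b sb cb; apply: E; first by rewrite size_rcons sb.
by rewrite -cats1 count_cat /= cb addn1.
Qed.

Lemma bsum_const (N k c : nat) : bsum N k (fun=> c) = 'C(N, k) * c.
Proof.
elim: N k => [|N IH] [|k] //=; first by rewrite IH addn0 !bin0.
by rewrite !IH binS mulnDl.
Qed.

Lemma bsum_small (N k : nat) (f : bitseq -> nat) : N < k -> bsum N k f = 0.
Proof.
move=> lt; rewrite (@eq_bsum _ _ _ (fun=> 0)) ?bsum_const ?muln0 // => b sb cb.
by have := count_size id b; lia.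
Qed.

Lemma bsumD (N k : nat) (f g : bitseq -> nat) :
  bsum N k (fun b => f b + g b) = bsum N k f + bsum N k g.
Proof.
elim: N k f g => [|N IH] k f g /=; first by rewrite mulnDr.
by rewrite IH addnACA; case: k => [|k]; rewrite ?IH.
Qed.

Lemma bsum_mull (N k c : nat) (f : bitseq -> nat) :
  bsum N k (fun b => c * f b) = c * bsum N k f.
Proof.
elim: N k f => [|N IH] k f /=; first by rewrite mulnCA.
by rewrite IH mulnDr; case: k => [|k]; rewrite ?IH ?muln0.
Qed.

(* Both sides run over the bit sequences of length N + 1 with k ones and one
   marked zero; on the right the mark is recorded by its rank among the zeros. *)
Lemma bsum_insert (N k : nat) (Psi : bitseq -> nat -> nat) :
  bsum N k (fun b => \sum_(j < (size b).+1)
                       Psi (insert j false b) (count negb (take j b))) =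
  bsum N.+1 k (fun b => \sum_(j < count negb b) Psi b j).
Proof.
have split_last c b (P : bitseq -> nat -> nat) : \sum_(j < (size (rcons b c)).+1)
      P (insert j false (rcons b c)) (count negb (take j (rcons b c))) =
    \sum_(j < (size b).+1) P (rcons (insert j false b) c) (count negb (take j b))
      + P (rcons (rcons b c) false) (count negb (rcons b c)).
  rewrite size_rcons big_ord_recr /=; congr (_ + _).
    apply: eq_bigr => j _; have hj := ltn_ord j; rewrite ltnS in hj.
    by rewrite /insert -!cats1 takel_cat // drop_catl // -catA.
  by rewrite /insert -(size_rcons b c) take_size drop_size cats1.
have count_rcons c b : count negb (rcons b c) = count negb b + ~~ c.
  by rewrite -cats1 count_cat /= addn0.
elim: N k Psi => [|N IH] k Psi.
  case: k => [|[|k]] /=; rewrite ?mul1n ?mul0n ?addn0 //=.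
  - by rewrite !big_ord1.
  - by rewrite big_ord0.
pose zero := fun b => Psi (rcons b false) (count negb b).
(* The last bit is an unmarked zero, a one, or the marked zero itself. *)
transitivity (bsum N.+1 k (fun b => \sum_(j < count negb b) Psi (rcons b false) j)
   + (if k is k'.+1 then
        bsum N.+1 k' (fun b => \sum_(j < count negb b) Psi (rcons b true) j)
      else 0)
   + bsum N.+1 k zero).
  rewrite -(IH k (fun b => Psi (rcons b false))).
  rewrite [LHS]bsumS (eq_bsum (fun b _ _ => split_last false b Psi)) bsumD.
  case: k => [|k]; first by rewrite /= !addn0.
  rewrite -(IH k (fun b => Psi (rcons b true))).
  rewrite (eq_bsum (fun b _ _ => split_last true b Psi)) bsumD addnACA.
  by congr (_ + _).
rewrite addnAC -bsumD [RHS]bsumS; congr (_ + _).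
  apply: eq_bsum => b _ _; rewrite /zero count_rcons addn1.
  by rewrite big_ord_recr.
case: k => // k; apply: eq_bsum => b _ _.
by rewrite count_rcons addn0.
Qed.

(** * Growing a word beyond the cut *)

(* The word is [rcons pre l ++ suf], cut after the right end of edge l, and k edges
   straddle the cut.  [f] sends their letters to 0 and relabels the edges inside
   [suf] as the matching [v]; [b] flags the positions of [suf] holding straddling
   edges. *)
Record marked (l : nat) (u pre suf : seq nat) (f : nat -> nat)
    (k : nat) (b : bitseq) (v : seq nat) : Prop := Marked {
  marked_u : [seq y <- rcons pre l | y <= l] = u;
  marked_size : (size pre).+1 = l.*2 + k;
  marked_pre : forall y, l <= y -> count_mem y pre <= 1;
  marked_suf : all (ltn l) suf;
  marked_bounded : bounded (rcons pre l ++ suf);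
  marked_b : b = [seq f y == 0 | y <- suf];
  marked_v : v = [seq z <- map f suf | z != 0];
  marked_v_bounded : bounded v;
  marked_single : forall y, f y = 0 -> count_mem y suf <= 1;
  marked_inj : {in suf &, forall y z, f y != 0 -> f y = f z -> y = z} }.

Lemma push_catl (s t : seq nat) (l j : nat) (x := (size (rcons s l ++ t))./2.+1) :
  j <= size s -> push (rcons s l ++ t) j = rcons (insert j x s) l ++ rcons t x.
Proof.
move=> hj; rewrite /push -/x /insert cat_rcons takel_cat // drop_catl //.
by rewrite -!cats1 -!catA /= -!catA.
Qed.

Lemma push_catr (s t : seq nat) (j : nat) (x := (size (s ++ t))./2.+1) :
  push (s ++ t) (size s + j) = s ++ rcons (insert j x t) x.
Proof.
rewrite /push -/x /insert take_cat drop_cat ltnNge leq_addr /= addKn.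
by rewrite -!cats1 -!catA.
Qed.

Lemma marked_new (l : nat) (u pre suf : seq nat) (f : nat -> nat)
    (k : nat) (b : bitseq) (v : seq nat) (x := (size (rcons pre l ++ suf))./2.+1) :
  marked l u pre suf f k b v -> [/\ l < x, x \notin pre & x \notin suf].
Proof.
move=> M; have := bounded_fresh (marked_bounded M); rewrite -/x => fr.
have : l \in rcons pre l ++ suf by rewrite mem_cat mem_rcons mem_head.
move/(allP (marked_bounded M)) => /= lx; split; first by rewrite ltnS.
  by apply: contra fr => h; rewrite mem_cat mem_rcons inE h orbT.
by apply: contra fr => h; rewrite mem_cat h orbT.
Qed.

(** The case where the new edge straddles the cut: its right end adds a one to [b], and [v] is
    unchanged. *)
Lemma marked_push_pre (l : nat) (u pre suf : seq nat) (f : nat -> nat)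
    (k : nat) (b : bitseq) (v : seq nat) (j : nat)
    (x := (size (rcons pre l ++ suf))./2.+1) :
  marked l u pre suf f k b v -> j <= size pre ->
  marked l u (insert j x pre) (rcons suf x)
    (fun y => if y == x then 0 else f y) k.+1 (rcons b true) v.
Proof.
move=> M hj; have [lx xp xs] := marked_new M; rewrite -/x in lx xp xs.
have fE : {in suf, (fun y => if y == x then 0 else f y) =1 f}.
  by move=> y hy; rewrite ifN //; apply: contraNneq xs => <-.
split.
- rewrite filter_rcons leqnn filter_insert leqNgt lx /=.
  by rewrite -(marked_u M) filter_rcons leqnn.
- by rewrite size_insert addnS (marked_size M).
- move=> y hy; rewrite count_insert /= eq_sym; have [->|_] := eqVneq y x.
    by rewrite (count_memPn xp).
  exact: (marked_pre M).
- by rewrite all_rcons /= lx (marked_suf M).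
- by rewrite -push_catl // bounded_push // (marked_bounded M).
- rewrite map_rcons eqxx (marked_b M); congr rcons.
  by apply/eq_in_map => y hy; congr (_ == 0); apply/esym/fE.
- rewrite map_rcons eqxx filter_rcons /= (marked_v M); congr filter.
  exact/esym/eq_in_map.
- exact: (marked_v_bounded M).
- move=> y; rewrite -cats1 count_cat /= addn0 [x == y]eq_sym.
  have [-> _|_ /(marked_single M)] := eqVneq y x; last by rewrite addn0.
  by rewrite (count_memPn xs).
move=> y z; rewrite !mem_rcons !inE.
case: (eqVneq y x) => //= yx hy; case: (eqVneq z x) => /= zx hz.
  by move=> /negPf h E; rewrite E eqxx in h.
exact: (marked_inj M).
Qed.

(** The case where the new edge lies after the cut. Since [v] forgets the straddling edges, its left
    end enters [v] at the number of zeros of [b] before place [j]. *)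
Lemma marked_push_suf (l : nat) (u pre suf : seq nat) (f : nat -> nat)
    (k : nat) (b : bitseq) (v : seq nat) (j : nat)
    (x := (size (rcons pre l ++ suf))./2.+1) :
  marked l u pre suf f k b v ->
  marked l u pre (rcons (insert j x suf) x)
    (fun y => if y == x then (size v)./2.+1 else f y) k
    (rcons (insert j false b) false) (push v (count negb (take j b))).
Proof.
move=> M; have [lx xp xs] := marked_new M; rewrite -/x in lx xp xs.
set c := (size v)./2.+1; set f' := fun y => _.
have fE : {in suf, f' =1 f}.
  by move=> y hy; rewrite /f' ifN //; apply: contraNneq xs => <-.
have f'x : f' x = c by rewrite /f' eqxx.
have ne_c y : y \in suf -> f y != c.
  move=> hy; apply/eqP=> E.
  have : c \in v by rewrite (marked_v M) mem_filter /= -E map_f.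
  by apply/negP; apply: bounded_fresh (marked_v_bounded M).
have Eb : count negb (take j b) = count (predC1 0) (take j (map f suf)).
  rewrite (marked_b M) -map_take count_map -map_take count_map.
  by apply: eq_count => y.
split.
- exact: (marked_u M).
- exact: (marked_size M).
- exact: (marked_pre M).
- rewrite all_rcons /= lx; apply/allP=> y; rewrite mem_insert => /orP[/eqP->//|].
  exact: (allP (marked_suf M)).
- by rewrite -push_catr bounded_push // (marked_bounded M).
- rewrite map_rcons map_insert f'x (marked_b M); congr (rcons (insert _ _ _) _).
  by apply/eq_in_map => y hy; congr (_ == 0); apply/esym/fE.
- rewrite map_rcons map_insert f'x filter_rcons filter_insert /= -/c.
  rewrite (_ : map f' suf = map f suf); last exact/eq_in_map.
  by rewrite -(marked_v M) -Eb.
- by rewrite bounded_push // (marked_v_bounded M).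
- move=> y; rewrite -cats1 count_cat count_insert /= addn0 /f' [x == y]eq_sym.
  have [-> //|_ /(marked_single M)] := eqVneq y x.
  by rewrite addn0.
move=> y z; rewrite !mem_rcons !inE !mem_insert /f' !orbA !orbb.
case: (eqVneq y x) => /= [->|yx] hy; case: (eqVneq z x) => /= [->//|zx] hz.
- by move=> _ E; have := ne_c _ hz; rewrite -E eqxx.
- by move=> _ E; have := ne_c _ hy; rewrite E eqxx.
exact: (marked_inj M).
Qed.

(** The value of [F] depends only on [k], [b] and [v]. The left ends of the straddling edges
    contribute 2l (2l + 1) ... (2l + k - 1), here a falling factorial, and [suf] has 2(d - k) + k
    positions. *)
Lemma sum_grow_marked (l : nat) (u' : seq nat) (u := rcons u' l) :
  0 < l -> size u = l.*2 -> bounded u ->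
  (forall y, l <= y -> count_mem y u' <= 1) ->
  forall d (F : seq nat -> nat) (Phi : nat -> bitseq -> seq nat -> nat),
  (forall pre suf f k b v, marked l u pre suf f k b v ->
     F (rcons pre l ++ suf) = Phi k b v) ->
  \sum_(w <- grow d u) F w =
  \sum_(k < d.+1) (l.*2.-1 + k) ^_ k *
    bsum (d.*2 - k) k (fun b => \sum_(v <- grow (d - k) [::]) Phi k b v).
Proof.
move=> l0 su bu once d; elim: d => [|d IH] F Phi coupled.
  rewrite big_seq1 big_ord1 /= mul1n big_seq1 ffactn0 mul1n.
  have M : marked l u u' [::] (fun=> 0) 0 [::] [::].
    split=> //; last by rewrite cats0.
      apply/all_filterP/allP=> y /(allP bu) /=.
      by rewrite su doubleK.
    by rewrite addn0 -su size_rcons.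
  by rewrite -(coupled _ _ _ _ _ _ M) cats0.
rewrite big_growS.
(* This is the sum of [F] over all pushes of a marked word; depending again only on [k], [b] and
   [v], it can replace [Phi] in the induction hypothesis. *)
pose Phi' k b v := (l.*2 + k) * Phi k.+1 (rcons b true) v +
  \sum_(j < (size b).+1)
    Phi k (rcons (insert j false b) false) (push v (count negb (take j b))).
rewrite (IH _ Phi'); last first.
  move=> pre suf f k b v M.
  have -> : (size (rcons pre l ++ suf)).+1 = (size pre).+1 + (size suf).+1.
    by rewrite size_cat size_rcons addnS.
  rewrite big_split_ord /=; congr (_ + _).
    rewrite -(marked_size M) -[X in X * _](card_ord (size pre).+1) -sum_nat_const.
    apply: eq_bigr => j _; have hj : j <= size pre by rewrite -ltnS.
    by rewrite push_catl // (coupled _ _ _ _ _ _ (marked_push_pre M hj)).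
  have -> : size b = size suf by rewrite (marked_b M) size_map.
  apply: eq_bigr => j _; rewrite -(size_rcons pre l) push_catr.
  by rewrite (coupled _ _ _ _ _ _ (marked_push_suf j M)).
(* [R1] collects the words whose last edge straddles the cut, making [k.+1] straddling edges; [R0]
   collects those whose last edge lies after the cut. *)
pose A k := (l.*2.-1 + k) ^_ k.
pose R1 k := bsum (d.*2 - k) k
  (fun b => \sum_(v <- grow (d - k) [::]) Phi k.+1 (rcons b true) v).
pose R0 k := bsum (d.*2.+1 - k) k
  (fun b => \sum_(v <- grow (d.+1 - k) [::]) Phi k (rcons b false) v).
transitivity (\sum_(k < d.+1) (A k.+1 * R1 k + A k * R0 k)).
  apply: eq_bigr => -[k hk] _ /=; rewrite ltnS in hk.
  have -> : A k.+1 = A k * (l.*2 + k).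
    by rewrite /A addnS ffactSS mulnC; congr (_ * _); lia.
  rewrite -/(A k) -mulnA -mulnDr; congr (_ * _).
  under eq_bsum => b sb cb do rewrite big_split -big_distrr /= exchange_big /=.
  rewrite bsumD bsum_mull; congr (_ + _).
  rewrite (bsum_insert _ _ (fun b j =>
    \sum_(v <- grow (d - k) [::]) Phi k (rcons b false) (push v j))).
  rewrite /R0 subSn; last by lia.
  apply: eq_bsum => b sb cb; rewrite (subSn hk) big_growS exchange_big /=.
  apply: eq_big_seq => v /matsP[_ sv]; rewrite sv.
  (* The zeros of [b], one of them marked, are as many as the insertion places of [v]. *)
  suff -> : count negb b = (d - k).*2.+1 by [].
  have := count_predC id b; rewrite sb cb => E.
  have -> : count negb b = count (predC id) b by apply: eq_count.
  lia.
pose B k := A k * bsum (d.+1.*2 - k) k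
  (fun b => \sum_(v <- grow (d.+1 - k) [::]) Phi k b v).
have B0 : B 0 = A 0 * R0 0.
  by rewrite /B /R0 !subn0 doubleS bsumS addn0.
have BS k : k <= d -> B k.+1 = A k.+1 * R0 k.+1 + A k.+1 * R1 k.
  move=> hk; rewrite /B doubleS (_ : d.*2.+2 - k.+1 = (d.*2 - k).+1); last by lia.
  by rewrite bsumS mulnDr /R0 /R1 !subSS.
rewrite -[RHS]/(\sum_(k < d.+2) B k) [RHS]big_ord_recl B0.
rewrite [X in _ = _ + X](eq_bigr (fun k : 'I_d.+1 => A k.+1 * R0 k.+1 + A k.+1 * R1 k)); last first.
  by move=> [k hk] _; exact: BS.
rewrite !big_split /= [RHS]addnA [RHS]addnC; congr (_ + _).
transitivity (\sum_(k < d.+2) A k * R0 k); last by rewrite big_ord_recl.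
(* Here [d] bits would have to contain [d.+1] ones. *)
have R0d : R0 d.+1 = 0 by apply: bsum_small; lia.
by rewrite [RHS]big_ord_recr /= R0d muln0 addn0.
Qed.

(** * Decomposition by the shortest prefix containing sigma *)

(** The index is shifted: the minimal prefixes counted here have [l.+1] edges. *)
Definition first_bad (sigma : seq nat) (l : nat) : nat :=
  \sum_(w <- grow l [::] | avoids w sigma)
    \sum_(j < (size w).+1 | ~~ avoids (push w j) sigma) 1.

Lemma big_grow_good (sigma : seq nat) (r : nat) (G : seq nat -> nat) :
  \sum_(w <- grow r.+1 [::] | avoids w sigma) G w =
  \sum_(w <- grow r [::] | avoids w sigma)
    \sum_(j < (size w).+1 | avoids (push w j) sigma) G (push w j).
Proof.
rewrite big_growS [RHS]big_mkcond; apply: eq_big_seq => w /matsP[bw _].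
case: ifP => // gw; rewrite big_pred0 // => j.
by apply: contraFF gw; apply: avoids_pushW.
Qed.

(** Each of the [tree l 1] avoiders of order [l] has [l.*2.+1] extensions, and the good ones are the
    avoiders of order [l.+1]. *)
Lemma first_badE (sigma : seq nat) (l : nat) :
  sigma = [:: 1; 2; 1; 2] \/ sigma = [:: 1; 2; 2; 1] ->
  tree l.+1 1 + first_bad sigma l = l.*2.+1 * tree l 1.
Proof.
move=> hs; rewrite -!(sum_good_tree _ hs) big_grow_good -big_split big_distrr /=.
rewrite big_seq_cond [RHS]big_seq_cond.
apply: eq_bigr => w /andP[/matsP[_ sw] _].
rewrite muln1 -sw -[RHS](card_ord (size w).+1) -sum1_card.
by rewrite [RHS](bigID (fun j : 'I__ => avoids (push w j) sigma)).
Qed.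

(** Induction on the number [r] of edges examined: words still good after [r] edges stay in the
    first sum, and those turning bad at edge [l.+1] move to the second. *)
Lemma sum_by_first_bad (sigma : seq nat) (n : nat) (F : seq nat -> nat)
    (H : nat -> nat -> nat) :
  avoids [::] sigma ->
  (forall l d w (j : nat), w \in grow l [::] -> avoids w sigma -> j <= size w ->
     ~~ avoids (push w j) sigma -> \sum_(w' <- grow d (push w j)) F w' = H l.+1 d) ->
  forall r, r <= n ->
  \sum_(w <- grow n [::]) F w =
    \sum_(w <- grow r [::] | avoids w sigma) \sum_(w' <- grow (n - r) w) F w' +
    \sum_(l < r) first_bad sigma l * H l.+1 (n - l.+1).
Proof.
move=> av0 HF; elim=> [|r IH] rn.
  by rewrite big_ord0 addn0 [RHS]big_mkcond big_seq1 av0 subn0.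
rewrite IH ?(ltnW rn) // big_ord_recr /= [RHS]addnCA addnC; congr (_ + _).
rewrite big_grow_good big_distrl -big_split /= big_seq_cond [RHS]big_seq_cond.
apply: eq_bigr => w /andP[hw gw]; rewrite (_ : n - r = (n - r.+1).+1); last by lia.
rewrite big_growSr (bigID (fun j : 'I__ => avoids (push w j) sigma)) /=.
congr (_ + _); rewrite big_distrl /=; apply: eq_bigr => j bad.
by rewrite mul1n (HF r) // -ltnS.
Qed.

(** [contains_juxt2] reduces the question to [suf]. There straddling edges show a single end, so
    [tau] ignores them, and [f] relabels the other letters injectively into [v]. *)
Lemma avoids_marked (sigma tau w : seq nat) (m j : nat) (l := (size w)./2.+1) :
  {in sigma, forall a, 1 < count_mem a sigma} -> {in sigma, forall a, a <= 2} ->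
  is_matching m tau -> bounded w -> avoids w sigma -> ~~ avoids (push w j) sigma ->
  forall pre suf f k b v, marked l (push w j) pre suf f k b v ->
  avoids (rcons pre l ++ suf) (juxt2 sigma tau) = avoids v tau.
Proof.
move=> dbl small /andP[/eqP ut /allP ct] bw gw bad pre suf f k b v M.
have tauP a : a \in tau -> 0 < a /\ count_mem a tau = 2.
  rewrite -mem_undup ut => ha; split; last exact/eqP/ct.
  by move: ha; rewrite mem_iota => /andP[].
congr negb; rewrite contains_juxt2 //.
- rewrite (marked_v M) filter_map contains_pattern_map.
    rewrite contains_pattern_filter // => [a /tauP[_ ->] //|y _ /= cy].
    by apply/eqP=> /(marked_single M); rewrite leqNgt cy.
  move=> y z; rewrite !mem_filter /= => /andP[fy hy] /andP[_ hz].
  exact: (marked_inj M).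
- by move=> a /tauP[].
- by rewrite (marked_u M); move: bad; rewrite negbK.
- rewrite (_ : [seq y <- _ | y < l] = w) //.
  rewrite -(filter_neq_push j bw) -/l -(marked_u M) -filter_predI.
  by apply: eq_filter => y /=; rewrite ltn_neqAle.
- exact: (marked_pre M).
- exact: (marked_suf M).
Qed.

Theorem theorem1 (sigma : seq nat) (m : nat) (tau : seq nat) (n : nat) :
  (sigma = [:: 1; 2; 1; 2] \/ sigma = [:: 1; 2; 2; 1]) ->
  is_matching m tau ->
  2 <= n ->
  num_avoiding n (juxt2 sigma tau) =
    catalan n +
    \sum_(2 <= l < n.+1) \sum_(0 <= k < (n - l).+1)
       'C(l.*2 - 1, l - 2) * 'C(l.*2 - 1 + k, k) * 'C((n - l).*2 - k, k)
         * k`! * num_avoiding (n - l - k) tau.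
Proof.
move=> hs mt n2.
have dbl : {in sigma, forall a, 1 < count_mem a sigma}.
  by case: hs => ->; apply/allP.
have small : {in sigma, forall a, a <= 2} by case: hs => ->; apply/allP.
have av0 : avoids [::] sigma.
  by apply/contains_patternP=> -[f _]; case: hs => ->.
pose F w := if avoids w (juxt2 sigma tau) then 1 else 0.
pose H l d := \sum_(k < d.+1) (l.*2.-1 + k) ^_ k *
  ('C(d.*2 - k, k) * num_avoiding (d - k) tau).
rewrite num_avoidingE big_mkcond (@sum_by_first_bad sigma n F H av0 _ n) //; last first.
  move=> l d w j hw gw hj bad; have [bw sw] := matsP hw.
  have Pj : push w j = rcons (insert j l.+1 w) l.+1 by rewrite /push sw doubleK.
  have mk := avoids_marked dbl small mt bw gw bad.
  have fr := bounded_fresh bw; rewrite sw doubleK Pj in mk fr *.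
  rewrite (@sum_grow_marked l.+1 _ _ _ _ _ d F
             (fun _ _ v => if avoids v tau then 1 else 0)) //.
  - by apply: eq_bigr => k _; rewrite bsum_const num_avoidingE -big_mkcond.
  - by rewrite size_rcons size_insert sw doubleS.
  - by rewrite -Pj bounded_push.
  - move=> y hy; rewrite count_insert /= (count_memPn _) ?addn0 ?leq_b1 //.
    by apply/negP=> /(allP bw); rewrite sw doubleK; lia.
  by move=> pre suf f k b v M; rewrite /F (mk _ _ _ _ _ _ M).
rewrite subnn; congr (_ + _).
  (* A word avoiding [sigma] avoids the juxtaposition, of which [sigma] is a prefix. *)
  rewrite -tree_catalan -(sum_good_tree n hs); apply: eq_bigr => w gw.
  rewrite big_seq1 /F (_ : avoids w _) //; apply: contra gw.
  case/contains_patternP=> f inj_f sub; apply/contains_patternP; exists f.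
    by move=> a b ha hb; apply: inj_f; rewrite mem_cat ?ha ?hb.
  by apply: subseq_trans sub; rewrite map_cat prefix_subseq.
case: n n2 => [|[|n]] // _; rewrite big_ord_recl /=.
(* Index 0 stands for prefixes of one edge, which cannot contain [sigma]; the other indices stand
   for orders from 2 on. *)
have -> : first_bad sigma 0 = 0.
  by have := first_badE 0 hs; rewrite /= !big_ord1 /=; lia.
rewrite mul0n add0n !big_add1 /= big_mkord; apply: eq_bigr => -[l hl] _ /=.
have := first_badE l.+1 hs; rewrite /bump /= add1n doubleS tree_first_bad.
move/addnI=> ->; rewrite /H big_mkord big_distrr /=.
apply: eq_bigr => k _; rewrite (_ : l.+2.*2 - 1 = l.*2.+3); last by lia.
rewrite (_ : l.+2 - 2 = l) ?doubleS; last by lia.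
by rewrite -bin_ffact !mulnA; congr (_ * _); rewrite -!mulnA [k`! * _]mulnC.
Qed.
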